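(* A sensing matrix $\hat{\mathbf{\Phi}}\in\mathbb{R}^{m\times n}$ that solves the optimization problem $$\min_{\hat{\mathbf{\Phi}}}\ \left\|\hat{\mathbf{\Phi}}\right\|_F^2\quad\text{s.t.}\quad \hat{\mathbf{\Phi}}\mathbf{\Psi}\mathbf{\Psi}^T\hat{\mathbf{\Phi}}^T=\mathbf{I}_m$$ is given by $$\hat{\mathbf{\Phi}}=\mathbf{U}_{\hat\Phi}\,\mathbf{\Lambda}_{\hat\Phi}\,\mathbf{J}_n\,\mathbf{U}_{\Psi}^T,$$ where $\mathbf{U}_{\hat\Phi}\in\mathbb{R}^{m\times m}$ is an arbitrary orthonormal matrix and $$\mathbf{\Lambda}_{\hat\Phi}=\left[\mathrm{Diag}\left(\frac{1}{\lambda^{\Psi}_m},\dots,\frac{1}{\lambda^{\Psi}_1}\right)\ \ \mathbf{O}_{m\times(n-m)}\right].$$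
   Context: Here $m\le n\le\hat n$ are positive integers, and $\mathbf{\Psi}\in\mathbb{R}^{n\times\hat n}$ is a given matrix (the dictionary) with singular value decomposition $\mathbf{\Psi}=\mathbf{U}_{\Psi}\mathbf{\Lambda}_{\Psi}\mathbf{V}_{\Psi}^T$, where $\mathbf{U}_{\Psi}\in\mathbb{R}^{n\times n}$ and $\mathbf{V}_{\Psi}\in\mathbb{R}^{\hat n\times\hat n}$ are orthonormal (i.e. orthogonal) matrices and $\mathbf{\Lambda}_{\Psi}\in\mathbb{R}^{n\times\hat n}$ has main diagonal entries $\lambda^{\Psi}_1\ge\lambda^{\Psi}_2\ge\dots\ge\lambda^{\Psi}_n\ge 0$ (the singular values of $\mathbf{\Psi}$) and all other entries zero. $\|\cdot\|_F$ is the Frobenius norm, $\mathbf{I}_m$ is the $m\times m$ identity matrix, $\mathbf{J}_n$ is the $n\times n$ anti-diagonal matrix (the identity matrix with the order of its columns reversed), $\mathbf{O}_{m\times(n-m)}$ is the $m\times(n-m)$ zero matrix, and $\mathrm{Diag}(a_1,\dots,a_m)$ is the diagonal matrix with the given diagonal entries.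
   Formalization: The zero block of Λ is placed first, [O Diag(1/λ_m,…,1/λ_1)], since with the printed order the matrix violates the constraint when m<n (e.g. m=1, Ψ=diag(2,1) gives 1/4≠1); λ_1,…,λ_m are assumed nonzero, as the reciprocals require. *)

(* Defs.v *)
From mathcomp Require Export all_boot all_order all_algebra.
From mathcomp Require Export reals.

Set Implicit Arguments.
Unset Strict Implicit.
Unset Printing Implicit Defensive.

Import Order.TTheory GRing.Theory Num.Theory.
Local Open Scope ring_scope.

Definition orthonormal_mx (R : realType) (n : nat) (U : 'M[R]_n) : Prop :=
  U *m U^T = 1%:M.

Definition frobenius_norm (R : realType) (m n : nat) (A : 'M[R]_(m, n)) : R :=
  Num.sqrt (\sum_i \sum_j A i j ^+ 2).

Definition rect_diag_mx (R : realType) (n p : nat) (lambda : 'I_n -> R) :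
    'M[R]_(n, p) :=
  \matrix_(i, j) (if (i == j :> nat) then lambda i else 0).

(* [lambda] lists n values, so this is a full list of the min(n, p) singular
   values only when n <= p. Indices start at 0: the k-th singular value is
   [lambda (k - 1)]. *)
Definition is_svd (R : realType) (n p : nat) (Psi : 'M[R]_(n, p))
    (U : 'M[R]_n) (lambda : 'I_n -> R) (V : 'M[R]_p) : Prop :=
  [/\ orthonormal_mx U,
      orthonormal_mx V,
      forall i j : 'I_n, (i <= j)%N -> lambda j <= lambda i,
      forall i : 'I_n, 0 <= lambda i
    & Psi = U *m rect_diag_mx p lambda *m V^T].

Definition antidiag_mx (R : realType) (n : nat) : 'M[R]_n :=
  colsub (@rev_ord n) 1%:M.

Definition feasible (R : realType) (m n p : nat) (Psi : 'M[R]_(n, p))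
    (Phi : 'M[R]_(m, n)) : Prop :=
  Phi *m Psi *m Psi^T *m Phi^T = 1%:M.

Definition solves (R : realType) (m n p : nat) (Psi : 'M[R]_(n, p))
    (Phi : 'M[R]_(m, n)) : Prop :=
  feasible Psi Phi /\
  forall Phi' : 'M[R]_(m, n), feasible Psi Phi' ->
    frobenius_norm Phi ^+ 2 <= frobenius_norm Phi' ^+ 2.

(* The m x n matrix [ O  Diag(1/lambda_m, ..., 1/lambda_1) ]. The zero block
   has to come first: right multiplication by [antidiag_mx] reverses the
   columns, so that the entry 1/lambda_k ends up in column k and meets the k-th
   left singular vector. With the zero block last, 1/lambda_k would meet the
   singular vector of index n - m + k instead, and the constraint would fail
   in general when m < n. *)
Definition Lambda_Phi (R : realType) (m n : nat) (le_mn : (m <= n)%N)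
    (lambda : 'I_n -> R) : 'M[R]_(m, n) :=
  castmx (erefl m, subnK le_mn)
    (row_mx (0 : 'M[R]_(m, n - m))
            (diag_mx (\row_(i < m) (lambda (widen_ord le_mn (rev_ord i)))^-1))).

(* Main.v *)
Require Import Defs.
From mathcomp Require Import zify lra.

Set Implicit Arguments.
Unset Strict Implicit.
Unset Printing Implicit Defensive.

Import Order.TTheory GRing.Theory Num.Theory.
Local Open Scope ring_scope.

(** In the coordinates [C = Phi' *m U_Psi] the constraint says that
    [Q i j = C i j * lambda j] has orthonormal rows. Its squared column norms
    [q j] are therefore at most 1 and add up to [m]. With
    [mu = (lambda (m - 1)) ^- 2], the squared norm [c j] of column [j] of [C]
    satisfies [c j >= mu * q j + (lambda j ^- 2 - mu)] for [j < m] and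
    [c j >= mu * q j] for the other columns; summing over [j] gives
    [\sum_(j < m) lambda j ^- 2], which the proposed matrix attains. *)

Lemma sqr_frobenius_norm (R : realType) m n (A : 'M[R]_(m, n)) :
  frobenius_norm A ^+ 2 = \sum_j \sum_i A i j ^+ 2.
Proof.
rewrite sqr_sqrtr; first exact: exchange_big.
by do 2!(apply: sumr_ge0 => ? _); exact: sqr_ge0.
Qed.

Lemma sqr_frobenius_norm_tr (R : realType) m n (A : 'M[R]_(m, n)) :
  frobenius_norm A ^+ 2 = \tr (A *m A^T).
Proof.
rewrite sqr_frobenius_norm exchange_big; apply: eq_bigr => i _.
by rewrite mxE; apply: eq_bigr => j _; rewrite mxE expr2.
Qed.

Lemma orthonormal_mxC (R : realType) n (U : 'M[R]_n) :
  orthonormal_mx U -> U^T *m U = 1%:M.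
Proof. exact: mulmx1C. Qed.

Lemma sqr_frobenius_norm_mulUr (R : realType) m n (A : 'M[R]_(m, n))
    (U : 'M[R]_n) :
  orthonormal_mx U -> frobenius_norm (A *m U) ^+ 2 = frobenius_norm A ^+ 2.
Proof.
move=> oU.
by rewrite !sqr_frobenius_norm_tr trmx_mul mulmxA -(mulmxA A) oU mulmx1.
Qed.

Lemma sqr_frobenius_norm_mulUl (R : realType) m n (A : 'M[R]_(m, n))
    (U : 'M[R]_m) :
  orthonormal_mx U -> frobenius_norm (U *m A) ^+ 2 = frobenius_norm A ^+ 2.
Proof.
move=> oU; rewrite !sqr_frobenius_norm_tr trmx_mul -mulmxA mxtrace_mulC.
by rewrite -!mulmxA (orthonormal_mxC oU) mulmx1.
Qed.

Lemma rect_diag_mx_mul_tr (R : realType) n p (lambda : 'I_n -> R) :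
  (n <= p)%N ->
  rect_diag_mx p lambda *m (rect_diag_mx p lambda)^T
    = diag_mx (\row_j lambda j ^+ 2).
Proof.
move=> le_np; apply/matrixP => i j; rewrite !mxE.
(* Row [i] is supported on column [i], which exists because [n <= p]. *)
rewrite (bigD1 (widen_ord le_np i)) //= !mxE /= eqxx big1 => [|k neq_ki].
  rewrite addr0 [j == i :> nat]eq_sym -val_eqE /=.
  by case: (i =P j :> nat) => [/val_inj->|_]; rewrite ?mulr0 // -expr2 mulr1n.
rewrite !mxE; case: eqP => [eq_ik|_]; last by rewrite mul0r.
by case/eqP: neq_ki; apply: val_inj.
Qed.

(** The factor [V] cancels in [Psi *m Psi^T], leaving [U *m diag(lambda ^+ 2) *m U^T]; in the
    variable [Phi *m U] the constraint is diagonally weighted. *)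
Lemma feasible_svd (R : realType) m n p (Psi : 'M[R]_(n, p)) (U : 'M[R]_n)
    (lambda : 'I_n -> R) (V : 'M[R]_p) (Phi : 'M[R]_(m, n)) :
  (n <= p)%N -> is_svd Psi U lambda V ->
  feasible Psi Phi <->
  (Phi *m U) *m diag_mx (\row_j lambda j ^+ 2) *m (Phi *m U)^T = 1%:M.
Proof.
move=> le_np [_ oV _ _ ->]; rewrite /feasible -(rect_diag_mx_mul_tr _ le_np).
rewrite !trmx_mul trmxK !mulmxA.
by rewrite -[_ *m V^T *m V]mulmxA (orthonormal_mxC oV) mulmx1.
Qed.

(** [P = Q^T *m Q] is symmetric and idempotent, so [P j j] is the squared norm of row [j] of [P],
    hence at least [P j j ^+ 2]. This forces [P j j <= 1]. *)
Lemma col_sqr_le1 (R : realType) m n (Q : 'M[R]_(m, n)) (j : 'I_n) :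
  Q *m Q^T = 1%:M -> \sum_i Q i j ^+ 2 <= 1.
Proof.
move=> oQ; set P := Q^T *m Q.
have Pjj : P j j = \sum_i Q i j ^+ 2.
  by rewrite mxE; apply: eq_bigr => i _; rewrite mxE expr2.
have PP : P *m P = P by rewrite mulmxA -(mulmxA Q^T) oQ mulmx1.
have trP : P^T = P by rewrite trmx_mul trmxK.
have : P j j ^+ 2 <= P j j.
  rewrite -[in leRHS]PP [leRHS]mxE (bigD1 j) //= -expr2.
  rewrite lerDl sumr_ge0 // => k _.
  have -> : P k j = P j k by rewrite -[in LHS]trP mxE.
  by rewrite -expr2 sqr_ge0.
by rewrite -Pjj; nra.
Qed.

Lemma weighted_col_bound (R : realType) m n (le_mn : (m <= n)%N)
    (lambda : 'I_n -> R) (C : 'M[R]_(m, n)) :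
  (0 < m)%N ->
  (forall i j : 'I_n, (i <= j)%N -> lambda j <= lambda i) ->
  (forall i, 0 <= lambda i) ->
  (forall i : 'I_m, lambda (widen_ord le_mn i) != 0) ->
  C *m diag_mx (\row_j lambda j ^+ 2) *m C^T = 1%:M ->
  \sum_(i < m) lambda (widen_ord le_mn i) ^- 2 <= frobenius_norm C ^+ 2.
Proof.
move=> m_gt0 lambda_dec lambda_ge0 lambda_neq0 feasC.
set Q := C *m diag_mx (\row_j lambda j).
have QE i j : Q i j = C i j * lambda j by rewrite /Q mul_mx_diag !mxE.
have oQ : Q *m Q^T = 1%:M.
  rewrite -feasC trmx_mul tr_diag_mx !mulmxA; congr (_ *m _).
  rewrite -mulmxA mulmx_diag; congr (_ *m diag_mx _).
  by apply/rowP => j; rewrite !mxE expr2.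
(* The last of the first [m] indices: [l0] is the smallest singular value that the proposed matrix
   inverts, and it separates head columns from tail columns. *)
have [i0 i0E] : {i0 : 'I_m | i0.+1 = m :> nat}.
  by case: m m_gt0 {le_mn lambda_neq0 C feasC Q QE oQ} => // k _; exists ord_max.
set l0 := lambda (widen_ord le_mn i0); set mu := l0 ^- 2.
have l0_gt0 : 0 < l0 by rewrite lt_def lambda_neq0 lambda_ge0.
pose c j := \sum_i C i j ^+ 2; pose q j := \sum_i Q i j ^+ 2.
have c_ge0 j : 0 <= c j by apply: sumr_ge0 => i _; exact: sqr_ge0.
have qE j : q j = c j * lambda j ^+ 2.
  by rewrite /c mulr_suml; apply: eq_bigr => i _; rewrite QE exprMn.
have sum_q : \sum_j q j = m%:R.
  by rewrite -sqr_frobenius_norm sqr_frobenius_norm_tr oQ mxtrace1.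
(* The gap between the two sides is [(mu - lambda j ^- 2) * (1 - q j)], a product of nonnegative
   factors. *)
have c_ge_head (j : 'I_n) :
    (j < m)%N -> mu * q j + (lambda j ^- 2 - mu) <= c j.
  move=> lt_jm; have l0_le : l0 <= lambda j.
    by apply: lambda_dec; rewrite /= -ltnS i0E.
  have lj_gt0 := lt_le_trans l0_gt0 l0_le.
  have -> : c j = lambda j ^- 2 * q j.
    by rewrite qE mulrC mulfK // expf_neq0 // gt_eqF.
  have q_le1 : q j <= 1 := col_sqr_le1 j oQ.
  have : lambda j ^- 2 <= mu.
    by rewrite lef_pV2 ?posrE ?exprn_gt0 // ler_pXn2r // nnegrE ltW.
  nra.
(* Here [lambda j] may vanish, so it is not inverted: [mu * q j = c j * (mu * lambda j ^+ 2)], and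
   the last factor is at most 1. *)
have c_ge_tail (j : 'I_n) : (m <= j)%N -> mu * q j <= c j.
  move=> le_mj; have le_l0 : lambda j <= l0.
    by apply: lambda_dec; apply: leq_trans le_mj; exact: ltnW (ltn_ord i0).
  rewrite qE mulrCA ler_piMr // mulrC ler_pdivrMr ?exprn_gt0 // mul1r.
  by rewrite ler_pXn2r // nnegrE ?lambda_ge0 // ltW.
have -> : frobenius_norm C ^+ 2 = \sum_j c j by exact: sqr_frobenius_norm.
(* As the [q j] add up to [m], the term [mu * m] cancels the [m] copies of [- mu]. *)
have -> : \sum_(i < m) lambda (widen_ord le_mn i) ^- 2
          = \sum_j (mu * q j + (if (j < m)%N then lambda j ^- 2 - mu else 0)).
  rewrite big_split /= -mulr_sumr sum_q -big_mkcond /=.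
  rewrite (big_ord_narrow le_mn) /= big_split /= sumrN sumr_const card_ord.
  by rewrite mulr_natr addrC subrK.
apply: ler_sum => j _; case: ltnP => [|le_mj]; first exact: c_ge_head.
by rewrite addr0 c_ge_tail.
Qed.

Lemma Lambda_Phi_antidiagE (R : realType) m n (le_mn : (m <= n)%N)
    (lambda : 'I_n -> R) (i : 'I_m) (j : 'I_n) :
  (Lambda_Phi le_mn lambda *m antidiag_mx R n) i j
    = (lambda j)^-1 *+ (j == widen_ord le_mn (rev_ord i)).
Proof.
rewrite /antidiag_mx mulmx_colsub mulmx1 mxE castmxE cast_ord_id mxE.
have lt_im := ltn_ord i; have lt_jn := ltn_ord j.
(* Column [j] of the product is column [n - 1 - j] of [Lambda_Phi]. It lies in the zero block when
   [m <= j]; otherwise it is column [l = m - 1 - j] of the diagonal block. *)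
case: splitP => l /= lE; have lt_l := ltn_ord l; rewrite !mxE.
  case: eqP => // /(congr1 val) /=; lia.
have -> : j = widen_ord le_mn (rev_ord l) by apply: val_inj => /=; lia.
rewrite -!val_eqE /= eqn_sub2lE // eqSS eq_sym.
by case: eqP => // /val_inj->.
Qed.

(** A general weight [d] serves two purposes: [d = lambda ^+ 2] gives the constraint, and [d = 1]
    gives the Frobenius norm. *)
Lemma Lambda_Phi_antidiag_gram (R : realType) m n (le_mn : (m <= n)%N)
    (lambda : 'I_n -> R) (d : 'rV[R]_n) :
  let B := Lambda_Phi le_mn lambda *m antidiag_mx R n in
  B *m diag_mx d *m B^T
    = diag_mx (\row_i (lambda (widen_ord le_mn (rev_ord i)) ^- 2
                        * d 0 (widen_ord le_mn (rev_ord i)))).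
Proof.
move=> B; have BE := Lambda_Phi_antidiagE le_mn lambda; rewrite -/B in BE.
apply/matrixP => i k; rewrite mul_mx_diag !mxE.
rewrite (bigD1 (widen_ord le_mn (rev_ord i))) //= big1 => [|j neq_j]; last first.
  by rewrite mxE BE (negPf neq_j) mulr0n !mul0r.
rewrite addr0 mxE [B^T _ _]mxE !BE eqxx mulr1n.
have -> : (widen_ord le_mn (rev_ord i) == widen_ord le_mn (rev_ord k)) = (i == k).
  by rewrite -(inj_eq (can_inj (@rev_ordK m))).
by rewrite mulrnAr mulrAC -expr2 exprVn.
Qed.

Theorem proposition3 (R : realType) (m n nhat : nat)
    (m_gt0 : (0 < m)%N) (le_mn : (m <= n)%N) (le_nnhat : (n <= nhat)%N)
    (Psi : 'M[R]_(n, nhat))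
    (U_Psi : 'M[R]_n) (lambda : 'I_n -> R) (V_Psi : 'M[R]_nhat)
    (svd_Psi : is_svd Psi U_Psi lambda V_Psi)
    (lambda_neq0 : forall i : 'I_m, lambda (widen_ord le_mn i) != 0)
    (U_Phi : 'M[R]_m) (U_Phi_orthonormal : orthonormal_mx U_Phi) :
  solves Psi (U_Phi *m Lambda_Phi le_mn lambda *m antidiag_mx R n *m U_Psi^T).
Proof.
have feasE := feasible_svd _ le_nnhat svd_Psi.
case: (svd_Psi) => oU _ lambda_dec lambda_ge0 _.
have /= := Lambda_Phi_antidiag_gram le_mn lambda; rewrite -(mulmxA U_Phi).
(* From here on, only the weighted Gram formula of [B] matters. *)
move: (_ *m antidiag_mx R n) => B gramB.
have PhiU : U_Phi *m B *m U_Psi^T *m U_Psi = U_Phi *m B.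
  by rewrite -mulmxA (orthonormal_mxC oU) mulmx1.
split=> [|Phi' /feasE feasPhi'].
  apply/feasE; rewrite PhiU trmx_mul !mulmxA -!(mulmxA U_Phi) gramB.
  rewrite [diag_mx _](_ : _ = 1%:M) ?mul1mx //.
  rewrite -diag_const_mx; congr (diag_mx _); apply/rowP => i; rewrite !mxE mulVf //.
  by rewrite expf_neq0.
rewrite -(sqr_frobenius_norm_mulUr _ oU) PhiU.
rewrite -(sqr_frobenius_norm_mulUr Phi' oU) sqr_frobenius_norm_mulUl //.
apply: le_trans (weighted_col_bound m_gt0 lambda_dec lambda_ge0 lambda_neq0 feasPhi').
(* An identity matrix is inserted as the constant weight 1 so that [gramB] applies; reindexing by
   [rev_ord] then restores the order of the singular values. *)
rewrite sqr_frobenius_norm_tr -[X in X *m _]mulmx1 -diag_const_mx.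
rewrite gramB mxtrace_diag (reindex_inj rev_ord_inj) /=.
apply: ler_sum => i _.
by rewrite !mxE mulr1 rev_ordK.
Qed.
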